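(* Let $a\in\mathbb Z\setminus\{0\}$ and let $(L_n(a,-1))_{n\in\mathbb Z}$ be the Lucas sequence of either the first or the second kind with parameters $(a,-1)$. Let $k\geq1$ be an integer and let $z\in\mathbb C$ with $z\neq 0$, $z\neq\frac{L_n(a,-1)}{L_{n-1}(a,-1)}$ for every $n\in\mathbb Z$ with $L_{n-1}(a,-1)\neq0$, and $z\neq\lim_{n\to\infty}\frac{L_n(a,-1)}{L_{n-1}(a,-1)}$, $z\neq\lim_{n\to\infty}\frac{-L_{n-1}(a,-1)}{L_n(a,-1)}$. Then (i) $\mathscr L_{a,-1,2k}\!\left(-\frac1z\right)=z^{2k}\,\mathscr L_{a,-1,2k}(z)$; (ii) $\mathscr L_{a,-1,2k}(a-z)=\mathscr L_{a,-1,2k}(z)$.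
   Context: For $a\in\mathbb Z\setminus\{0\}$, the Lucas sequence $L_n(a,-1)$ satisfies $L_n(a,-1)=aL_{n-1}(a,-1)+L_{n-2}(a,-1)$. For the first kind, $L_0(a,-1)=0$, $L_1(a,-1)=1$, and negative indices are defined by $L_{-n}(a,-1)=(-1)^{n-1}L_n(a,-1)$ for $n\geq1$. For the second kind, $L_0(a,-1)=2$, $L_1(a,-1)=a$, and $L_{-n}(a,-1)=(-1)^nL_n(a,-1)$ for $n\ge1$. In both cases the recursion then holds for all $n\in\mathbb Z$. For an integer $m>1$ and $z$ in the domain described in the claim, define $$\mathscr L_{a,-1,m}(z)=\sum_{j=-\infty}^{\infty}\left(L_j(a,-1)\,z+L_{j-1}(a,-1)\right)^{-m}.$$ *)

(* Defs.v *)
From Stdlib Require Import Reals ZArith.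
From Coquelicot Require Import Coquelicot.

Inductive lucas_kind : Set := FirstKind | SecondKind.

Definition lucas_init (kd : lucas_kind) (a : Z) : Z * Z :=
  match kd with
  | FirstKind => (0, 1)%Z
  | SecondKind => (2, a)%Z
  end.

(* The pair (L_n(a,-1), L_{n+1}(a,-1)). *)
Fixpoint lucas_pair (kd : lucas_kind) (a : Z) (n : nat) : Z * Z :=
  match n with
  | O => lucas_init kd a
  | S n' => let (u, v) := lucas_pair kd a n' in (v, a * v + u)%Z
  end.

Definition lucas (kd : lucas_kind) (a n : Z) : Z :=
  match n with
  | Z0 => fst (lucas_pair kd a 0)
  | Zpos p => fst (lucas_pair kd a (Pos.to_nat p))
  | Zneg p =>
      (match kd with
       | FirstKind => (-1) ^ (Zpos p - 1)
       | SecondKind => (-1) ^ Zpos p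
       end * fst (lucas_pair kd a (Pos.to_nat p)))%Z
  end.

(* Both one-sided series converge, so the partial sums over [-p, q] converge
   as p and q tend to infinity independently. *)
Definition is_bilateral_series (f : Z -> C) (s : C) : Prop :=
  exists s1 s2 : C,
    is_series (fun n : nat => f (Z.of_nat n)) s1 /\
    is_series (fun n : nat => f (- Z.of_nat (S n))%Z) s2 /\
    s = Cplus s1 s2.

(* Unspecified when the series does not converge. *)
Definition bilateral_series (f : Z -> C) : C :=
  iota (T := C_CompleteNormedModule) (is_bilateral_series f).

Definition lucas_form (kd : lucas_kind) (a : Z) (z : C) (j : Z) : C :=
  (RtoC (IZR (lucas kd a j)) * z + RtoC (IZR (lucas kd a (j - 1))))%C.

Definition lucas_term (kd : lucas_kind) (a : Z) (m : nat) (z : C) (j : Z) : C :=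
  (/ (lucas_form kd a z j ^ m))%C.

Definition lucas_L (kd : lucas_kind) (a : Z) (m : nat) (z : C) : C :=
  bilateral_series (lucas_term kd a m z).

(* The series has a value at z. The first conjunct is needed because Cinv is
   total. *)
Definition lucas_L_defined (kd : lucas_kind) (a : Z) (m : nat) (z : C) : Prop :=
  (forall j : Z, lucas_form kd a z j <> RtoC 0) /\
  exists s : C, is_bilateral_series (lucas_term kd a m z) s.

Definition lucas_ratio_limit (kd : lucas_kind) (a : Z) : R :=
  real (Lim_seq (fun n : nat =>
    (IZR (lucas kd a (Z.of_nat n)) / IZR (lucas kd a (Z.of_nat n - 1)))%R)).

Definition lucas_neg_inv_ratio_limit (kd : lucas_kind) (a : Z) : R :=
  real (Lim_seq (fun n : nat =>
    (- IZR (lucas kd a (Z.of_nat n - 1)) / IZR (lucas kd a (Z.of_nat n)))%R)).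

(* Main.v *)
Require Import Defs.
From Stdlib Require Import Reals ZArith.
From Coquelicot Require Import Coquelicot.
From Stdlib Require Import Lra Lia.

(** Write f_j(z) = L_j z + L_{j-1}. Since L_{-j} = e_j L_j with signs e_j that
    alternate in j, one has f_j(a - z) = - e_j f_{-j}(z) and
    f_j(-1/z) = - e_j z^{-1} f_{1-j}(z); even powers kill the signs, and
    reindexing the bilateral series by j -> -j and j -> 1 - j gives both
    functional equations. For convergence, let r, s be the roots of
    x^2 = a x + 1 with |r| > 1 > |s|. By Binet's formula |f_j(z)| grows like
    |r|^j as j -> +oo provided z <> s, and the terms with j < 0 are those of
    the series at a - z with j > 0, where a - z <> s because z <> r. *)

(* The sign e_j in [lucas kd a (- j) = e_j * lucas kd a j]. *)
Definition reflection_sign (kd : lucas_kind) (j : Z) : Z :=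
  match kd, Z.even j with
  | FirstKind, true | SecondKind, false => -1
  | FirstKind, false | SecondKind, true => 1
  end.

(** * Parity signs and the Lucas recurrence over all integers *)

Lemma reflection_sign_succ kd j :
  reflection_sign kd (j + 1) = (- reflection_sign kd j)%Z.
Proof.
unfold reflection_sign.
rewrite Z.add_1_r, Z.even_succ, <- Z.negb_even.
now destruct kd, (Z.even j).
Qed.

Lemma reflection_sign_sqr kd j :
  (reflection_sign kd j * reflection_sign kd j = 1)%Z.
Proof. unfold reflection_sign; now destruct kd, (Z.even j). Qed.

Lemma reflection_sign_opp kd j :
  reflection_sign kd (- j) = reflection_sign kd j.
Proof. unfold reflection_sign; now rewrite Z.even_opp. Qed.

Lemma pow_m1_parity n : (0 <= n)%Z ->
  ((-1) ^ n = if Z.even n then 1 else -1)%Z.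
Proof.
intros hn.
change (-1)%Z with (- (1))%Z at 1.
destruct (Z.even n) eqn:E.
- apply Z.even_spec in E; rewrite Z.pow_opp_even by easy; now apply Z.pow_1_l.
- assert (O : Z.odd n = true) by now rewrite <- Z.negb_even, E.
  apply Z.odd_spec in O; rewrite Z.pow_opp_odd by easy; now rewrite Z.pow_1_l.
Qed.

Lemma lucas_opp kd a j :
  lucas kd a (- j) = (reflection_sign kd j * lucas kd a j)%Z.
Proof.
assert (H : forall p, lucas kd a (Zneg p)
    = (reflection_sign kd (Zpos p) * lucas kd a (Zpos p))%Z).
{ intros p; unfold lucas; f_equal; unfold reflection_sign.
  destruct kd; rewrite pow_m1_parity by lia; try easy.
  rewrite <- (Z.succ_pred (Zpos p)) at 2.
  rewrite Z.even_succ, <- Z.negb_even, <- Z.sub_1_r.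
  now destruct (Z.even (Z.pos p - 1)). }
(* At index 0 the sign for [FirstKind] is -1, which is consistent because L_0 = 0 there. *)
destruct j as [|p|p]; [now destruct kd | apply H |].
change (- Zneg p)%Z with (Zpos p); rewrite H.
change (Zneg p) with (- Zpos p)%Z.
rewrite reflection_sign_opp, Z.mul_assoc, reflection_sign_sqr; ring.
Qed.

Lemma lucas_nat kd a n : lucas kd a (Z.of_nat n) = fst (lucas_pair kd a n).
Proof.
destruct n as [|n]; [easy|].
change (lucas kd a (Z.of_nat (S n)))
  with (fst (lucas_pair kd a (Pos.to_nat (Pos.of_succ_nat n)))).
now rewrite SuccNat2Pos.id_succ.
Qed.

Lemma lucas_1 kd a :
  lucas kd a 1 = match kd with FirstKind => 1 | SecondKind => a end%Z.
Proof. now destruct kd. Qed.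

Lemma lucas_m1 kd a :
  lucas kd a (-1) = match kd with FirstKind => 1 | SecondKind => - a end%Z.
Proof.
change (-1)%Z with (- (1))%Z; rewrite lucas_opp, lucas_1.
destruct kd; cbn -[Z.mul]; ring.
Qed.

(** For positive [j] this is the recursion defining [lucas_pair]; reflection carries it to negative
    [j], and [j = 0] is where the two halves meet. *)
Lemma lucas_rec kd a j :
  lucas kd a (j + 1) = (a * lucas kd a j + lucas kd a (j - 1))%Z.
Proof.
assert (H : forall n : nat, lucas kd a (Z.of_nat n + 2)
    = (a * lucas kd a (Z.of_nat n + 1) + lucas kd a (Z.of_nat n))%Z).
{ intros n.
  replace (Z.of_nat n + 2)%Z with (Z.of_nat (S (S n))) by lia.
  replace (Z.of_nat n + 1)%Z with (Z.of_nat (S n)) by lia.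
  rewrite !lucas_nat; simpl.
  now destruct (lucas_pair kd a n). }
destruct (Z_lt_le_dec 0 j) as [hj|hj].
- specialize (H (Z.to_nat (j - 1))); rewrite Z2Nat.id in H by lia.
  now replace (j + 1)%Z with (j - 1 + 2)%Z by ring; rewrite H;
    replace (j - 1 + 1)%Z with j by ring.
- destruct (Z.eq_dec j 0) as [->|hj0].
  { change (lucas kd a 1 = a * lucas kd a 0 + lucas kd a (-1))%Z.
    rewrite lucas_1, lucas_m1; destruct kd; cbn -[Z.mul Z.add Z.opp]; ring. }
  (* Reflecting L_{1-j} = a L_{-j} + L_{-j-1} gives e_{j-1} L_{j-1} = a e_j L_j + e_{j+1} L_{j+1}.
     Both outer signs equal -e_j, so cancelling e_j yields the claim. *)
  specialize (H (Z.to_nat (- j - 1))); rewrite Z2Nat.id in H by lia.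
  replace (- j - 1 + 2)%Z with (- (j - 1))%Z in H by ring.
  replace (- j - 1 + 1)%Z with (- j)%Z in H by ring.
  replace (- j - 1)%Z with (- (j + 1))%Z in H by ring.
  rewrite !lucas_opp in H.
  replace (reflection_sign kd (j + 1)) with (- reflection_sign kd j)%Z in H
    by (symmetry; apply reflection_sign_succ).
  assert (E := reflection_sign_succ kd (j - 1)).
  replace (j - 1 + 1)%Z with j in E by ring.
  replace (reflection_sign kd (j - 1)) with (- reflection_sign kd j)%Z in H
    by lia.
  assert (S := reflection_sign_sqr kd j).
  apply (Z.mul_reg_l _ _ (reflection_sign kd j)); [|lia].
  intros e; rewrite e in S; lia.
Qed.

(** * Transformation of the linear forms and of the terms *)

(** The recurrence turns the left side into L_{j+1} - L_j z. On the right, f_{-j}(z) = e_j (L_j z -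
    L_{j+1}), and e_j^2 = 1. *)
Lemma lucas_form_reflect kd a z j :
  lucas_form kd a (RtoC (IZR a) - z) j
  = (- RtoC (IZR (reflection_sign kd j)) * lucas_form kd a z (- j))%C.
Proof.
unfold lucas_form.
replace (- j - 1)%Z with (- (j + 1))%Z by ring.
rewrite !lucas_opp, reflection_sign_succ.
assert (S := reflection_sign_sqr kd j).
apply (f_equal (fun x => RtoC (IZR x))) in S.
rewrite mult_IZR, RtoC_mult in S.
assert (E := lucas_rec kd a j).
apply (f_equal (fun x => RtoC (IZR x))) in E.
rewrite plus_IZR, mult_IZR, RtoC_plus, RtoC_mult in E.
rewrite !mult_IZR, opp_IZR, !RtoC_mult, RtoC_opp.
set (e := RtoC (IZR (reflection_sign kd j))) in *.
set (u := RtoC (IZR (lucas kd a (j - 1)))) in *.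
replace u with (RtoC (IZR (lucas kd a (j + 1)))
  - RtoC (IZR a) * RtoC (IZR (lucas kd a j)))%C by (rewrite E; ring).
transitivity ((e * e) * (RtoC (IZR (lucas kd a (j + 1)))
  - RtoC (IZR (lucas kd a j)) * z))%C; [rewrite S|]; ring.
Qed.

(** Here the signs alone suffice: f_{1-j}(z) = e_j (L_j - L_{j-1} z), while the left side is L_{j-1}
    - L_j / z. *)
Lemma lucas_form_inv kd a z j : z <> RtoC 0 ->
  lucas_form kd a (- (1 / z)) j
  = (- RtoC (IZR (reflection_sign kd j)) * / z * lucas_form kd a z (1 - j))%C.
Proof.
intros hz; unfold lucas_form.
replace (1 - j - 1)%Z with (- j)%Z by ring.
replace (1 - j)%Z with (- (j - 1))%Z by ring.
rewrite !lucas_opp.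
assert (P := reflection_sign_succ kd (j - 1)).
replace (j - 1 + 1)%Z with j in P by ring.
replace (reflection_sign kd (j - 1)) with (- reflection_sign kd j)%Z by lia.
assert (S := reflection_sign_sqr kd j).
apply (f_equal (fun x => RtoC (IZR x))) in S.
rewrite mult_IZR, RtoC_mult in S.
rewrite !mult_IZR, opp_IZR, !RtoC_mult, RtoC_opp.
set (e := RtoC (IZR (reflection_sign kd j))) in *.
transitivity ((e * e) * (RtoC (IZR (lucas kd a (j - 1)))
  - RtoC (IZR (lucas kd a j)) * / z))%C; [rewrite S|]; field; exact hz.
Qed.

Lemma reflection_sign_pow_even kd j k :
  ((- RtoC (IZR (reflection_sign kd j))) ^ (2 * k))%C = RtoC 1.
Proof.
rewrite Cpow_mult_r.
replace ((- RtoC (IZR (reflection_sign kd j))) ^ 2)%C with (RtoC 1).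
- apply Cpow_1_l.
- assert (S := reflection_sign_sqr kd j).
  apply (f_equal (fun x => RtoC (IZR x))) in S.
  rewrite mult_IZR, RtoC_mult in S; rewrite <- S; simpl; ring.
Qed.

Lemma lucas_term_reflect kd a k z j :
  lucas_term kd a (2 * k) (RtoC (IZR a) - z) j = lucas_term kd a (2 * k) z (- j).
Proof.
unfold lucas_term.
rewrite lucas_form_reflect, Cpow_mult_l, reflection_sign_pow_even.
now rewrite Cmult_1_l.
Qed.

Lemma lucas_term_inv kd a k z j : z <> RtoC 0 ->
  lucas_form kd a z (1 - j) <> RtoC 0 ->
  lucas_term kd a (2 * k) (- (1 / z)) j
  = (z ^ (2 * k) * lucas_term kd a (2 * k) z (1 - j))%C.
Proof.
intros hz hf; unfold lucas_term.
rewrite lucas_form_inv, !Cpow_mult_l, reflection_sign_pow_even, Cpow_inv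
  by easy.
assert (hz' := Cpow_nz z (2 * k) hz).
assert (hf' := Cpow_nz _ (2 * k) hf).
field; now split.
Qed.

(** * Reindexing, scaling and uniqueness of bilateral sums *)

Lemma is_bilateral_series_ext f g s :
  (forall j, f j = g j) -> is_bilateral_series f s -> is_bilateral_series g s.
Proof.
intros H (s1 & s2 & h1 & h2 & e); exists s1, s2; split; [|split; [|easy]].
- now apply is_series_ext with (2 := h1); intros n.
- now apply is_series_ext with (2 := h2); intros n.
Qed.

(** Reversal swaps the two halves, except that index 0 always belongs to the nonnegative one; hence
    [f 0] moves between the two sums. *)
Lemma is_bilateral_series_opp f s :
  is_bilateral_series f s -> is_bilateral_series (fun j => f (- j)%Z) s.
Proof.
intros (s1 & s2 & h1 & h2 & ->).
exists (s2 + f 0%Z)%C, (s1 - f 0%Z)%C; split; [|split]; [| |ring].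
- apply is_series_decr_1.
  change (is_series (fun k => f (- Z.of_nat (S k))%Z)
    (s2 + f 0%Z - f 0%Z)%C).
  now replace (s2 + f 0%Z - f 0%Z)%C with s2 by ring.
- apply is_series_ext with (fun k => f (Z.of_nat (S k))).
  { intros n; now rewrite Z.opp_involutive. }
  apply (is_series_incr_1 (fun k => f (Z.of_nat k))).
  change (is_series (fun n => f (Z.of_nat n)) (s1 - f 0%Z + f 0%Z)%C).
  now replace (s1 - f 0%Z + f 0%Z)%C with s1 by ring.
Qed.

Lemma is_bilateral_series_shift f s :
  is_bilateral_series f s -> is_bilateral_series (fun j => f (j + 1)%Z) s.
Proof.
intros (s1 & s2 & h1 & h2 & ->).
exists (s1 - f 0%Z)%C, (s2 + f 0%Z)%C; split; [|split]; [| |ring].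
- apply is_series_ext with (fun k => f (Z.of_nat (S k))).
  { intros n; f_equal; lia. }
  apply (is_series_incr_1 (fun k => f (Z.of_nat k))).
  change (is_series (fun n => f (Z.of_nat n)) (s1 - f 0%Z + f 0%Z)%C).
  now replace (s1 - f 0%Z + f 0%Z)%C with s1 by ring.
- apply is_series_decr_1.
  change (is_series (fun k => f (- Z.of_nat (S (S k)) + 1)%Z)
    (s2 + f 0%Z - f 0%Z)%C).
  replace (s2 + f 0%Z - f 0%Z)%C with s2 by ring.
  apply is_series_ext with (2 := h2); intros n; f_equal; lia.
Qed.

Lemma is_bilateral_series_scal c f s :
  is_bilateral_series f s -> is_bilateral_series (fun j => c * f j)%C (c * s)%C.
Proof.
intros (s1 & s2 & h1 & h2 & ->).
exists (c * s1)%C, (c * s2)%C; split; [|split]; [| |ring].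
- exact (is_series_scal c _ _ h1).
- exact (is_series_scal c _ _ h2).
Qed.

(** [iota] returns the sum once it is known to be unique, and each half has a unique limit. *)
Lemma bilateral_series_unique f s :
  is_bilateral_series f s -> bilateral_series f = s.
Proof.
intros h; apply (iota_unique (V := C_CompleteNormedModule)); [|exact h].
destruct h as (s1 & s2 & h1 & h2 & ->); intros y (t1 & t2 & g1 & g2 & ->).
f_equal.
- exact (filterlim_locally_unique (V := C_NormedModule) _ _ _ g1 h1).
- exact (filterlim_locally_unique (V := C_NormedModule) _ _ _ g2 h2).
Qed.

(** * Binet's formula, growth of the forms and convergence *)

(** Since a = r + s and r s = -1, L_{n+1} - s L_n = r L_n + L_{n-1} = r (L_n - s L_{n-1}): a
    geometric progression. It is also used with [r] and [s] exchanged. *)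
Lemma lucas_minus_root kd a (r s : R) (n : nat) :
  (r + s = IZR a)%R -> (r * s = -1)%R ->
  (IZR (lucas kd a (Z.of_nat n)) - s * IZR (lucas kd a (Z.of_nat n - 1))
   = r ^ n * (IZR (lucas kd a 0) - s * IZR (lucas kd a (-1))))%R.
Proof.
intros hs hp; induction n as [|n IH]; [simpl; ring|].
replace (Z.of_nat (S n)) with (Z.of_nat n + 1)%Z by lia.
rewrite lucas_rec, Z.add_simpl_r, plus_IZR, mult_IZR, <- hs.
simpl pow; rewrite Rmult_assoc, <- IH.
set (x := IZR (lucas kd a (Z.of_nat n))).
set (y := IZR (lucas kd a (Z.of_nat n - 1))).
transitivity (r * x - r * s * y)%R; [rewrite hp|]; ring.
Qed.

(** The coefficient is -s for the first kind and 2 + a s = 1 + s^2 for the second. *)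
Lemma lucas_root_coef_neq0 kd a (r s : R) :
  (r + s = IZR a)%R -> (r * s = -1)%R ->
  (IZR (lucas kd a 0) - s * IZR (lucas kd a (-1)) <> 0)%R.
Proof.
intros hs hp.
rewrite lucas_m1; destruct kd; simpl; [nra|].
rewrite opp_IZR, <- hs; nra.
Qed.

(** Binet's formula for the form, obtained by combining the two geometric progressions. The
    coefficient of r^n contains z - s, so growth can fail at z = s. *)
Lemma lucas_form_closed kd a z (r s : R) (n : nat) :
  (r + s = IZR a)%R -> (r * s = -1)%R ->
  (RtoC (r - s) * lucas_form kd a z (Z.of_nat n)
   = RtoC (r ^ n) * (RtoC (IZR (lucas kd a 0) - s * IZR (lucas kd a (-1)))
       * (RtoC r * (z - RtoC s)))
     - RtoC (s ^ n) * (RtoC (IZR (lucas kd a 0) - r * IZR (lucas kd a (-1)))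
       * (RtoC s * (z - RtoC r))))%C.
Proof.
intros hs hp; unfold lucas_form.
assert (E1 := lucas_minus_root kd a r s n hs hp).
assert (E2 := lucas_minus_root kd a s r n ltac:(lra) ltac:(lra)).
apply (f_equal RtoC) in E1, E2, hp.
rewrite RtoC_mult in E1, E2.
transitivity ((RtoC (r ^ n) * RtoC (IZR (lucas kd a 0) - s * IZR (lucas kd a (-1))))
       * (RtoC r * (z - RtoC s))
     - (RtoC (s ^ n) * RtoC (IZR (lucas kd a 0) - r * IZR (lucas kd a (-1))))
       * (RtoC s * (z - RtoC r)))%C; [|ring].
rewrite <- E1, <- E2.
rewrite !RtoC_minus, !RtoC_mult in *.
set (x := RtoC (IZR (lucas kd a (Z.of_nat n)))).
set (y := RtoC (IZR (lucas kd a (Z.of_nat n - 1)))).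
transitivity ((RtoC r - RtoC s) * (x * z - (RtoC r * RtoC s) * y))%C;
  [rewrite hp|]; ring.
Qed.

Lemma Rabs_other_root_lt_1 (r s : R) :
  (r * s = -1)%R -> (1 < Rabs r)%R -> (Rabs s < 1)%R.
Proof.
intros hp hr.
assert (e : (Rabs r * Rabs s = 1)%R)
  by (rewrite <- Rabs_mult, hp, Rabs_left; lra).
assert (0 <= Rabs s)%R by apply Rabs_pos; nra.
Qed.

Lemma lucas_form_growth kd a z (r s : R) :
  (r + s = IZR a)%R -> (r * s = -1)%R -> (1 < Rabs r)%R -> z <> RtoC s ->
  exists (c : R) (N : nat), (0 < c)%R /\ forall n : nat, (N <= n)%nat ->
    (c * Rabs r ^ n <= Cmod (lucas_form kd a z (Z.of_nat n)))%R.
Proof.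
intros hs hp hr hz.
set (D1 := (RtoC (IZR (lucas kd a 0) - s * IZR (lucas kd a (-1)))
       * (RtoC r * (z - RtoC s)))%C).
set (D2 := (RtoC (IZR (lucas kd a 0) - r * IZR (lucas kd a (-1)))
       * (RtoC s * (z - RtoC r)))%C).
assert (h1 : (0 < Cmod D1)%R).
{ apply Cmod_gt_0; unfold D1.
  apply Cmult_neq_0; [|apply Cmult_neq_0].
  - intros e; apply RtoC_inj in e; now apply (lucas_root_coef_neq0 kd a r s) in e.
  - intros e; apply RtoC_inj in e; nra.
  - intros e; apply hz; replace z with ((z - RtoC s) + RtoC s)%C by ring.
    rewrite e; ring. }
assert (hsr := Rabs_other_root_lt_1 r s hp hr).
assert (hd : (0 < Rabs (r - s))%R).
{ apply Rabs_pos_lt; nra. }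
(* From [N] on, the [D2] term, bounded by [Cmod D2] since |s| < 1, is at most half of the [D1] term;
   this is the factor 2 in the constant below. *)
destruct (Pow_x_infinity r ltac:(lra) (2 * Cmod D2 / Cmod D1)) as [N hN].
exists (Cmod D1 / (2 * Rabs (r - s)))%R, N; split.
{ apply Rdiv_lt_0_compat; lra. }
intros n hn; specialize (hN n hn); rewrite <- RPow_abs in hN.
assert (E := lucas_form_closed kd a z r s n hs hp); fold D1 D2 in E.
set (F := lucas_form kd a z (Z.of_nat n)) in *.
assert (T : (Rabs r ^ n * Cmod D1 <= Rabs (r - s) * Cmod F + Cmod D2)%R).
{ assert (e : (RtoC (r ^ n) * D1 = RtoC (r - s) * F + RtoC (s ^ n) * D2)%C)
    by (rewrite E; ring).
  apply (f_equal Cmod) in e.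
  rewrite Cmod_mult, Cmod_R, <- RPow_abs in e; rewrite e.
  eapply Rle_trans; [apply Cmod_triangle|].
  rewrite !Cmod_mult, !Cmod_R, <- RPow_abs.
  assert (Rabs s ^ n <= 1)%R.
  { rewrite <- (pow1 n); apply pow_incr; split; [apply Rabs_pos|lra]. }
  assert (0 <= Cmod D2)%R by apply Cmod_ge_0; nra. }
assert (U : (2 * Cmod D2 <= Rabs r ^ n * Cmod D1)%R).
{ apply Rge_le in hN; apply (Rmult_le_compat_r (Cmod D1)) in hN; [|lra].
  eapply Rle_trans; [|exact hN]; right; field; lra. }
apply (Rmult_le_reg_l (2 * Rabs (r - s))); [lra|].
replace (2 * Rabs (r - s) * (Cmod D1 / (2 * Rabs (r - s)) * Rabs r ^ n))%R
  with (Rabs r ^ n * Cmod D1)%R by (field; lra).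
lra.
Qed.

Lemma ex_series_lucas_term kd a m z (r s : R) : (1 <= m)%nat ->
  (r + s = IZR a)%R -> (r * s = -1)%R -> (1 < Rabs r)%R -> z <> RtoC s ->
  ex_series (V := C_NormedModule)
    (fun n : nat => lucas_term kd a m z (Z.of_nat n)).
Proof.
intros hm hs hp hr hz.
destruct (lucas_form_growth kd a z r s hs hp hr hz) as (c & N & hc & hN).
(* The lower bound holds only from [N] on. The tail is compared with a geometric series of ratio
   |r|^(-m), and [d] absorbs the factor |r|^N. *)
apply (ex_series_incr_n _ N).
set (d := (c * Rabs r ^ N)%R).
assert (hd : (0 < d)%R) by (apply Rmult_lt_0_compat, pow_lt; lra).
apply (ex_series_le (V := C_CompleteNormedModule) _
  (fun n => scal (/ d ^ m)%R ((/ Rabs r ^ m) ^ n)%R)).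
- intros n; change (Cmod (lucas_term kd a m z (Z.of_nat (N + n)))
    <= / d ^ m * (/ Rabs r ^ m) ^ n)%R.
  specialize (hN (N + n)%nat ltac:(lia)); rewrite pow_add in hN.
  assert (hn : (0 < Rabs r ^ n)%R) by (apply pow_lt; lra).
  assert (h : (d * Rabs r ^ n <= Cmod (lucas_form kd a z (Z.of_nat (N + n))))%R)
    by (unfold d; lra).
  unfold lucas_term; rewrite Cmod_inv, Cmod_pow.
  + rewrite pow_inv, <- pow_mult, Nat.mul_comm, pow_mult, <- Rinv_mult.
    rewrite <- Rpow_mult_distr.
    apply Rinv_le_contravar; [apply pow_lt; nra|].
    apply pow_incr; split; [nra|easy].
  + apply Cpow_nz, Cmod_gt_0; nra.
- apply (ex_series_scal (V := R_NormedModule)), ex_series_geom.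
  rewrite <- pow_inv, <- RPow_abs, Rabs_inv, Rabs_Rabsolu.
  destruct m as [|m]; [lia|].
  apply pow_lt_1_compat; [|lia]; split.
  + left; apply Rinv_0_lt_compat; lra.
  + rewrite <- Rinv_1; apply Rinv_lt_contravar; lra.
Qed.

(** * The dominant root and the two excluded limits *)

(** The root whose square-root term has the sign of [a] has modulus (|a| + t) / 2, at least 3/2
    because |a| >= 1 and t >= 2. *)
Lemma exists_dominant_root (a : Z) : a <> 0%Z ->
  exists r s : R, (r + s = IZR a)%R /\ (r * s = -1)%R /\ (1 < Rabs r)%R.
Proof.
intros ha; set (t := sqrt (IZR a * IZR a + 4)).
assert (ht : (t * t = IZR a * IZR a + 4)%R) by (apply sqrt_sqrt; nra).
assert (ht0 : (0 <= t)%R) by apply sqrt_pos.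
assert (ht2 : (2 <= t)%R) by nra.
destruct (Z_lt_le_dec 0 a) as [h|h].
- assert (1 <= IZR a)%R by (apply IZR_le; lia).
  exists ((IZR a + t) / 2)%R, ((IZR a - t) / 2)%R; repeat split; [lra|nra|].
  rewrite Rabs_right; lra.
- assert (IZR a <= -1)%R by (apply IZR_le; lia).
  exists ((IZR a - t) / 2)%R, ((IZR a + t) / 2)%R; repeat split; [lra|nra|].
  rewrite Rabs_left; lra.
Qed.

(** The geometric progression for the other root gives L_n - r L_{n-1} = D s^n. Dividing by L_{n-1},
    a nonzero integer for large n, leaves an error of at most |D| |s|^n. *)
Lemma is_lim_seq_lucas_ratio kd a (r s : R) :
  (r + s = IZR a)%R -> (r * s = -1)%R -> (1 < Rabs r)%R ->
  is_lim_seq (fun n : nat =>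
    (IZR (lucas kd a (Z.of_nat n)) / IZR (lucas kd a (Z.of_nat n - 1)))%R) r.
Proof.
intros hs hp hr.
assert (hs1 := Rabs_other_root_lt_1 r s hp hr).
(* At z = 0 the form is L_{n-1}, so the growth bound shows that it is eventually nonzero. *)
destruct (lucas_form_growth kd a (RtoC 0) r s hs hp hr) as (c & N & hc & hN).
{ intros e; apply RtoC_inj in e; subst s; lra. }
set (D := (IZR (lucas kd a 0) - r * IZR (lucas kd a (-1)))%R).
assert (L : is_lim_seq (fun n => (Rabs D * Rabs s ^ n)%R) 0%R).
{ replace (Finite 0) with (Rbar_mult (Rabs D) 0%R) by (simpl; f_equal; ring).
  apply is_lim_seq_scal_l, is_lim_seq_geom; now rewrite Rabs_Rabsolu. }
assert (K : is_lim_seq (fun n : nat => (IZR (lucas kd a (Z.of_nat n))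
    / IZR (lucas kd a (Z.of_nat n - 1)) - r)%R) 0%R).
{ apply is_lim_seq_abs_0.
  apply is_lim_seq_le_le_loc with (fun _ => 0%R) (fun n => (Rabs D * Rabs s ^ n)%R);
    [|apply is_lim_seq_const|exact L].
  exists N; intros n hn; split; [apply Rabs_pos|].
  specialize (hN n hn).
  assert (hne : lucas kd a (Z.of_nat n - 1) <> 0%Z).
  { intros e; unfold lucas_form in hN; rewrite e in hN.
    rewrite Cmult_0_r, Cplus_0_l, Cmod_0 in hN.
    assert (0 < Rabs r ^ n)%R by (apply pow_lt; lra); nra. }
  assert (E := lucas_minus_root kd a s r n ltac:(lra) ltac:(lra)); fold D in E.
  set (x := IZR (lucas kd a (Z.of_nat n))) in *.
  assert (hy0 := eq_IZR_contrapositive _ _ hne).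
  assert (hy : (1 <= Rabs (IZR (lucas kd a (Z.of_nat n - 1))))%R).
  { rewrite <- abs_IZR; apply IZR_le; lia. }
  set (y := IZR (lucas kd a (Z.of_nat n - 1))) in *.
  replace (x / y - r)%R with (s ^ n * D * / y)%R by (rewrite <- E; field; easy).
  rewrite !Rabs_mult, <- RPow_abs, Rabs_inv.
  assert (/ Rabs y <= 1)%R
    by (rewrite <- Rinv_1; apply Rinv_le_contravar; lra).
  assert (0 <= Rabs s ^ n * Rabs D)%R
    by (apply Rmult_le_pos; [apply pow_le|]; apply Rabs_pos).
  nra. }
apply is_lim_seq_ext with (fun n : nat => (IZR (lucas kd a (Z.of_nat n))
    / IZR (lucas kd a (Z.of_nat n - 1)) - r + r)%R); [intros n; ring|].
replace (Finite r) with (Finite (0 + r)) by (f_equal; ring).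
apply is_lim_seq_plus'; [exact K|apply is_lim_seq_const].
Qed.

Lemma lucas_ratio_limit_eq kd a (r s : R) :
  (r + s = IZR a)%R -> (r * s = -1)%R -> (1 < Rabs r)%R ->
  lucas_ratio_limit kd a = r.
Proof.
intros hs hp hr; unfold lucas_ratio_limit.
now rewrite (is_lim_seq_unique _ _ (is_lim_seq_lucas_ratio kd a r s hs hp hr)).
Qed.

Lemma lucas_neg_inv_ratio_limit_eq kd a (r s : R) :
  (r + s = IZR a)%R -> (r * s = -1)%R -> (1 < Rabs r)%R ->
  lucas_neg_inv_ratio_limit kd a = s.
Proof.
intros hs hp hr; unfold lucas_neg_inv_ratio_limit.
assert (hr0 : r <> 0%R) by nra.
assert (e : s = (- / r)%R) by (apply (Rmult_eq_reg_l r); [rewrite hp; field|]; easy).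
rewrite (is_lim_seq_unique _ s); [easy|].
apply is_lim_seq_ext with (fun n : nat => (- / (IZR (lucas kd a (Z.of_nat n))
    / IZR (lucas kd a (Z.of_nat n - 1))))%R).
(* This holds for every [n], even where a Lucas number vanishes, because [/ 0 = 0]. *)
{ intros n; unfold Rdiv; rewrite Rinv_mult, Rinv_inv; ring. }
rewrite e; apply (is_lim_seq_opp _ (Finite (/ r))).
apply (is_lim_seq_inv _ (Finite r)); [now apply (is_lim_seq_lucas_ratio kd a r s)|].
now intros h; apply hr0; injection h.
Qed.

(** * Nonvanishing of the linear forms *)

(** Two consecutive zeros would annihilate r^n (L_0 - s L_{-1}), a product of nonzero factors.
    Negative indices reduce to this by reflection. *)
Lemma lucas_consecutive_neq0 kd a j : a <> 0%Z ->
  lucas kd a j = 0%Z -> lucas kd a (j - 1) <> 0%Z.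
Proof.
intros ha.
assert (H : forall n : nat, lucas kd a (Z.of_nat n) = 0%Z ->
    lucas kd a (Z.of_nat n - 1) <> 0%Z).
{ intros n h1 h2.
  destruct (exists_dominant_root a ha) as (r & s & hs & hp & _).
  assert (E := lucas_minus_root kd a r s n hs hp); rewrite h1, h2 in E.
  assert (C := lucas_root_coef_neq0 kd a r s hs hp).
  assert (P : (r ^ n <> 0)%R) by (apply pow_nonzero; nra).
  apply (Rmult_integral_contrapositive_currified _ _ P C); lra. }
destruct (Z_lt_le_dec j 0) as [hj|hj].
- intros h1 h2; apply (H (Z.to_nat (1 - j))); rewrite Z2Nat.id by lia.
  + replace (1 - j)%Z with (- (j - 1))%Z by ring.
    rewrite lucas_opp, h2; ring.
  + replace (1 - j - 1)%Z with (- j)%Z by ring.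
    rewrite lucas_opp, h1; ring.
- specialize (H (Z.to_nat j)); now rewrite Z2Nat.id in H.
Qed.

(** A zero of f_j with L_j <> 0 is -L_{j-1} / L_j = L_{1-j} / L_{-j}, the excluded ratio with n = 1
    - j. If L_j = 0, the form is the nonzero constant L_{j-1}. *)
Lemma lucas_form_neq0 kd a z : a <> 0%Z ->
  (forall n : Z, lucas kd a (n - 1) <> 0%Z ->
     z <> (RtoC (IZR (lucas kd a n)) / RtoC (IZR (lucas kd a (n - 1))))%C) ->
  forall j, lucas_form kd a z j <> RtoC 0.
Proof.
intros ha hn j e.
destruct (Z.eq_dec (lucas kd a j) 0) as [h|h].
- unfold lucas_form in e; rewrite h, Cmult_0_l, Cplus_0_l in e.
  apply RtoC_inj, eq_IZR in e; now apply (lucas_consecutive_neq0 kd a j).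
- assert (S := reflection_sign_sqr kd j).
  assert (hl : lucas kd a (1 - j - 1) <> 0%Z).
  { replace (1 - j - 1)%Z with (- j)%Z by ring; rewrite lucas_opp; nia. }
  apply (hn _ hl).
  assert (hl' : RtoC (IZR (lucas kd a (1 - j - 1))) <> RtoC 0)
    by (intros e'; now apply RtoC_inj, eq_IZR in e').
  replace (lucas kd a (1 - j)) with
    (- (reflection_sign kd j * lucas kd a (j - 1)))%Z.
  2: { replace (1 - j)%Z with (- (j - 1))%Z by ring; rewrite lucas_opp.
    assert (P := reflection_sign_succ kd (j - 1)).
    rewrite Z.sub_add in P; rewrite P; ring. }
  match goal with |- z = (?u / ?d)%C =>
    enough (E : (z * d)%C = u) by (rewrite <- E; now field) end.
  replace (1 - j - 1)%Z with (- j)%Z by ring; rewrite lucas_opp.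
  rewrite opp_IZR, !mult_IZR, RtoC_opp, !RtoC_mult.
  unfold lucas_form in e.
  set (q := RtoC (IZR (reflection_sign kd j))).
  set (x := RtoC (IZR (lucas kd a j))) in *.
  set (y := RtoC (IZR (lucas kd a (j - 1)))) in *.
  transitivity (q * (x * z + y) - q * y)%C; [|rewrite e]; ring.
Qed.

(** * Bilateral convergence and the functional equations *)

Lemma ex_bilateral_lucas_term kd a k z (r s : R) : (1 <= k)%nat ->
  (r + s = IZR a)%R -> (r * s = -1)%R -> (1 < Rabs r)%R ->
  z <> RtoC r -> z <> RtoC s ->
  exists S, is_bilateral_series (lucas_term kd a (2 * k) z) S.
Proof.
intros hk hs hp hr hzr hzs.
destruct (ex_series_lucas_term kd a (2 * k) z r s) as [s1 h1]; try easy; [lia|].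
assert (hz' : (RtoC (IZR a) - z)%C <> RtoC s).
{ intros e; apply hzr.
  replace z with (RtoC (IZR a) - (RtoC (IZR a) - z))%C by ring.
  rewrite e, <- hs, RtoC_plus; ring. }
assert (h2 := ex_series_lucas_term kd a (2 * k) _ r s ltac:(lia) hs hp hr hz').
(* The series at a - z starts at index 0, whereas the negative half at z starts at -1, so the first
   term is dropped. *)
apply ex_series_incr_1 in h2; destruct h2 as [s2 h2].
exists (s1 + s2)%C, s1, s2; split; [exact h1|split; [|easy]].
apply is_series_ext with (2 := h2); intros n; apply lucas_term_reflect.
Qed.

Theorem theorem3 (kd : lucas_kind) (a : Z) (ha : a <> 0%Z)
  (k : nat) (hk : (1 <= k)%nat) (z : C)
  (hz0 : z <> RtoC 0)
  (hzn : forall n : Z, lucas kd a (n - 1) <> 0%Z ->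
     z <> (RtoC (IZR (lucas kd a n)) / RtoC (IZR (lucas kd a (n - 1))))%C)
  (hzlim1 : z <> RtoC (lucas_ratio_limit kd a))
  (hzlim2 : z <> RtoC (lucas_neg_inv_ratio_limit kd a)) :
  lucas_L_defined kd a (2 * k) z /\
  (lucas_L_defined kd a (2 * k) (- (1 / z))%C /\
   lucas_L kd a (2 * k) (- (1 / z))%C
   = (z ^ (2 * k) * lucas_L kd a (2 * k) z)%C) /\
  (lucas_L_defined kd a (2 * k) (RtoC (IZR a) - z)%C /\
   lucas_L kd a (2 * k) (RtoC (IZR a) - z)%C
   = lucas_L kd a (2 * k) z).
Proof.
destruct (exists_dominant_root a ha) as (r & s & hs & hp & hr).
rewrite (lucas_ratio_limit_eq kd a r s hs hp hr) in hzlim1.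
rewrite (lucas_neg_inv_ratio_limit_eq kd a r s hs hp hr) in hzlim2.
assert (hf := lucas_form_neq0 kd a z ha hzn).
destruct (ex_bilateral_lucas_term kd a k z r s hk hs hp hr hzlim1 hzlim2)
  as [S hS].
assert (hsign : forall j, (- RtoC (IZR (reflection_sign kd j)))%C <> RtoC 0).
{ intros j e; assert (P := reflection_sign_pow_even kd j 1).
  rewrite e in P; apply (f_equal fst) in P; simpl in P; lra. }
assert (hinv : is_bilateral_series (lucas_term kd a (2 * k) (- (1 / z)))
    (z ^ (2 * k) * S)%C).
(* Shifting and then reversing amounts to the reindexing j -> 1 - j. *)
{ assert (H := is_bilateral_series_opp _ _ (is_bilateral_series_shift _ _
    (is_bilateral_series_scal (z ^ (2 * k))%C _ _ hS))).
  apply is_bilateral_series_ext with (2 := H); intros j; simpl.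
  replace (- j + 1)%Z with (1 - j)%Z by ring.
  symmetry; now apply lucas_term_inv. }
assert (hrefl : is_bilateral_series (lucas_term kd a (2 * k) (RtoC (IZR a) - z))
    S).
{ apply is_bilateral_series_ext with (2 := is_bilateral_series_opp _ _ hS).
  intros j; symmetry; apply lucas_term_reflect. }
unfold lucas_L.
rewrite (bilateral_series_unique _ _ hS), (bilateral_series_unique _ _ hinv),
  (bilateral_series_unique _ _ hrefl).
split; [|split; (split; [|easy])]; split; try (eexists; eassumption); try easy;
  intros j.
(* What remains is that no denominator vanishes at -1/z or a - z; each form there is a nonzero
   multiple of a form at z. *)
- rewrite lucas_form_inv by easy.
  apply Cmult_neq_0; [apply Cmult_neq_0|]; try easy.
  intros e; apply C1_nz; rewrite <- (Cinv_r z), e by easy; ring.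
- rewrite lucas_form_reflect; now apply Cmult_neq_0.
Qed.
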